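(* Let $q=p^l$ be a prime power ($p$ prime) and $\mathbb{F}_q$ the finite field of order $q$. Let $\mathcal{D}$ be a $1$-$(v,k,r)$ design with blocks $B_1,\ldots,B_b$ such that $k\equiv 0\pmod p$ and $|B_i\cap B_j|\equiv d\pmod p$ for all $i,j\in\{1,\ldots,b\}$, $i\neq j$. Let $G$ be an automorphism group of $\mathcal{D}$ which acts on $\mathcal{D}$ with $f_1$ fixed points and $n$ point orbits of length $p^\alpha$, $1\leq\alpha\leq l$, and with $f_2$ fixed blocks and $m$ block orbits of length $p^\alpha$. Let $OM1$ and $OM2$ be, respectively, the submatrix of the orbit matrix indexed by fixed blocks and fixed points, and the submatrix indexed by block orbits and point orbits of length $p^\alpha$. Then: 1. the linear code spanned by the rows of the matrix $[\sqrt{d}\cdot I_{f_2},\ OM1,\ \sqrt{-d}\cdot\mathbf{1}]$ is a self-orthogonal $[f_2+f_1+1,f_2]$ code over the field $\mathbb{F}$, where $\mathbb{F}=\mathbb{F}_q$ if $d$ and $-d$ are squares in $\mathbb{F}_q$, and $\mathbb{F}=\mathbb{F}_{q^2}$ otherwise; 2. the linear code spanned by the rows of the matrix $[\sqrt{d}\cdot I_m,\ OM2]$ is a self-orthogonal $[m+n,m]$ code over the field $\mathbb{F}$, where $\mathbb{F}=\mathbb{F}_q$ if $d$ is a square in $\mathbb{F}_q$, and $\mathbb{F}=\mathbb{F}_{q^2}$ otherwise. If $m=n$, the obtained code is self-dual.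
   Context: A $1$-$(v,k,r)$ design is a finite incidence structure with $v$ points and $b$ blocks such that every block is incident with exactly $k$ points and every point is incident with exactly $r$ blocks. For blocks $B_i,B_j$, $|B_i\cap B_j|$ is the number of points incident with both; $d$ is a residue modulo $p$, viewed as an element of $\mathbb{F}_p\subseteq\mathbb{F}_q$. An automorphism group of $\mathcal{D}$ is a group of incidence-preserving bijections (points to points, blocks to blocks) of $\mathcal{D}$. The point orbits of $G$ are the $f_1$ fixed points and the $n$ orbits of length $p^\alpha$, and the block orbits are the $f_2$ fixed blocks and the $m$ orbits of length $p^\alpha$. The orbit matrix under $G$ has rows indexed by block orbits $\mathcal{B}_i$ and columns by point orbits $\mathcal{V}_j$, with entry $a_{i,j}$ equal to the number of points of $\mathcal{V}_j$ incident with a block of $\mathcal{B}_i$ (independent of the chosen block). Order the orbits so that fixed points (columns $1,\ldots,f_1$) and fixed blocks (rows $1,\ldots,f_2$) come first. Then $OM1=[a_{i,j}]_{1\le i\le f_2,\,1\le j\le f_1}$ and $OM2=[a_{f_2+i,f_1+j}]_{1\le i\le m,\,1\le j\le n}$, with entries viewed in the field under consideration. $I_N$ is the $N\times N$ identity matrix, $\mathbf{1}$ the all-one column, and $[X,Y,\ldots]$ denotes horizontal concatenation. For $c\in\mathbb{F}_p$, viewed in $\mathbb{F}$, $\sqrt{c}$ denotes an element of $\mathbb{F}$ whose square is $c$. An $[N,K]$ code has length $N$ and dimension $K$. A code $C\subseteq\mathbb{F}^N$ is self-orthogonal if $C\subseteq C^\perp$ and self-dual if $C=C^\perp$, where $C^\perp$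 is the dual under the standard (bilinear) inner product.
   Formalization: The dimension claims (f_2 and m) and the self-duality claim for m=n are stated only for d not divisible by p, since they fail for d≡0 mod p (the matrix can be zero); self-orthogonality is stated for all d. *)

(* Defs.v *)
From HB Require Import structures.
From mathcomp Require Import all_boot all_order all_algebra all_fingroup.
Set Implicit Arguments. Unset Strict Implicit. Unset Printing Implicit Defensive.
Import GRing.Theory.
Local Open Scope ring_scope.

(* Points and blocks are two finite types and [I x y] means
   that the point [x] is incident with the block [y]; distinct elements of [B]
   may be incident with the same points (repeated blocks). *)

Definition design1 (P B : finType) (I : P -> B -> bool) (v k r : nat) : Prop :=
  [/\ #|P| = v,
      forall y : B, #|[set x : P | I x y]| = k
    & forall x : P, #|[set y : B | I x y]| = r].

Definition block_meet (P B : finType) (I : P -> B -> bool) (y z : B) : nat :=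
  #|[set x : P | I x y && I x z]|.

Definition design_aut (P B : finType) (I : P -> B -> bool)
    : {set {perm P} * {perm B}} :=
  [set g : {perm P} * {perm B} |
    [forall x, forall y, I (g.1 x) (g.2 y) == I x y]].

Definition point_act (P B : finType) := ('P \o @fst_morphism {perm P} {perm B})%act.
Definition block_act (P B : finType) := ('P \o @snd_morphism {perm P} {perm B})%act.

(* [V] lists every orbit of [G] exactly once: first [f] fixed elements (as
   singleton orbits), then [n] orbits of length [s]. *)
Definition orbit_list (gT : finGroupType) (D : {group gT}) (T : finType)
    (to : action D T) (G : {set gT}) (s f n : nat)
    (V : 'I_(f + n) -> {set T}) : Prop :=
  [/\ injective V,
      [set V i | i : 'I_(f + n)] = [set orbit to G x | x : T],
      forall i : 'I_f, #|V (lshift n i)| = 1%N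
    & forall i : 'I_n, #|V (rshift f i)| = s].

(* Entries are computed with an arbitrary block of the orbit; [orbit_entryE]
   shows that the choice is irrelevant. *)
Definition orbit_entry (P B : finType) (I : P -> B -> bool)
    (Y : {set B}) (X : {set P}) : nat :=
  if [pick y in Y] is Some y then #|[set x in X | I x y]| else 0%N.

Definition orbit_mx (P B : finType) (I : P -> B -> bool) (M N : nat)
    (BO : 'I_M -> {set B}) (PO : 'I_N -> {set P}) : 'M[nat]_(M, N) :=
  \matrix_(i, j) orbit_entry I (BO i) (PO j).

Lemma orbit_entryE (P B : finType) (I : P -> B -> bool)
    (G : {group {perm P} * {perm B}}) (x0 : P) (y0 y : B) :
  G \subset design_aut I -> y \in orbit (@block_act P B) G y0 ->
  orbit_entry I (orbit (@block_act P B) G y0) (orbit (@point_act P B) G x0)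
    = #|[set x in orbit (@point_act P B) G x0 | I x y]|.
Proof.
move=> sGA.
have autG g x z : g \in G -> I (g.1 x) (g.2 z) = I x z.
  by move/(subsetP sGA); rewrite inE => /forallP/(_ x)/forallP/(_ z)/eqP.
have moveG g x : g \in G -> x \in orbit (@point_act P B) G x0 ->
    g.1 x \in orbit (@point_act P B) G x0.
  move=> gG /imsetP[h hG ->]; apply/imsetP; exists (h * g)%g.
    exact: groupM.
  by rewrite /= /comp_act /aperm /= permM.
have H z : z \in orbit (@block_act P B) G y0 ->
   #|[set x in orbit (@point_act P B) G x0 | I x z]| =
   #|[set x in orbit (@point_act P B) G x0 | I x y0]|.
  case/imsetP=> g gG ->.
  rewrite -[RHS](card_imset _ (@perm_inj _ g.1)); apply: eq_card => x.
  rewrite inE; apply/andP/imsetP => [[xO Ix]|[w]].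
    have gVG : g^-1%g \in G by rewrite groupV.
    exists ((g.1)^-1 x)%g; last by rewrite permKV.
    by rewrite inE (moveG _ _ gVG xO) -(autG g) // permKV.
  by rewrite inE => /andP[wO Iw] ->; rewrite moveG // [I _ _]autG.
move=> yO; rewrite /orbit_entry; case: pickP => [z zO|/(_ y)].
  by rewrite !H.
by rewrite yO.
Qed.

Definition is_square (F : finFieldType) (c : F) : bool :=
  [exists s : F, s ^+ 2 == c].

Definition row_code (F : finFieldType) (M N : nat) (A : 'M[F]_(M, N))
    : {vspace 'rV[F]_N} :=
  <<[seq row i A | i : 'I_M]>>%VS.

Definition dotr (F : finFieldType) (N : nat) (u w : 'rV[F]_N) : F :=
  \sum_(i < N) u 0 i * w 0 i.

Definition dual_code (F : finFieldType) (N : nat) (C : {vspace 'rV[F]_N})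
    : {set 'rV[F]_N} :=
  [set u | [forall w in C, dotr u w == 0]].

Definition self_orthogonal (F : finFieldType) (N : nat)
    (C : {vspace 'rV[F]_N}) : Prop := {subset C <= dual_code C}.

Definition self_dual (F : finFieldType) (N : nat)
    (C : {vspace 'rV[F]_N}) : Prop := C =i dual_code C.

(* The generator matrices are built from the whole orbit matrix: OM1 is its
   upper left and OM2 its lower right block. *)
Definition gen1 (F : finFieldType) (f2 m f1 n : nat)
    (a : 'M[nat]_(f2 + m, f1 + n)) (s t : F) : 'M[F]_(f2, f2 + f1 + 1) :=
  row_mx (row_mx (s *: 1%:M) (map_mx (fun c : nat => c%:R) (ulsubmx a)))
         (const_mx t).

Definition gen2 (F : finFieldType) (f2 m f1 n : nat)
    (a : 'M[nat]_(f2 + m, f1 + n)) (s : F) : 'M[F]_(m, m + n) :=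
  row_mx (s *: 1%:M) (map_mx (fun c : nat => c%:R) (drsubmx a)).

(* Main.v *)
Require Import Defs.
From HB Require Import structures.
From mathcomp Require Import all_boot all_order all_algebra all_fingroup.
From mathcomp Require Import cyclic finfield zify.
Set Implicit Arguments. Unset Strict Implicit. Unset Printing Implicit Defensive.
Import GRing.Theory.
Local Open Scope ring_scope.

(** Fix a field of characteristic [p] and let [a] be the orbit matrix.  For a
    block [y] in the row orbit [i] and another row orbit [i'], count the pairs
    [(x, z)] with [x] incident with both [y] and [z], and [z] in orbit [i'].
    Summed over [z], the count is a sum of the numbers [block_meet I y z], all
    equal to [d] modulo [p] except the one with [z = y], which is [0]; hence it
    is [d * (#|orbit i'| - (i == i'))].  Summed over the point orbits [j], the
    part of the count in [j] is [#|orbit i'| / #|orbit j| * a i j * a i' j]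
    ([card_flags_on]), because double counting the flags between two orbits
    gives the number of blocks of orbit [i'] on a point of orbit [j]
    ([flag_count]).

    For rows [i], [i'] and a column [j] of the same length the quotient is [1],
    so these columns together contribute an entry of a Gram matrix.  The other
    columns contribute multiples of [p]: for long rows and a fixed point the
    quotient is [p ^ alpha], and for fixed rows and a long column it is the
    inverse of [p ^ alpha], but both entries are multiples of [p ^ alpha].
    Thus [OM1 OM1^T] has entries [d * (1 - (i == i'))] ([fixed_gram]) and
    [OM2 OM2^T = - d I] ([moved_gram]).  The columns [sqrt d I] and
    [sqrt (- d) 1] cancel exactly these values, so both generator matrices
    satisfy [A A^T = 0].  When [d] is not zero the block [sqrt d I] is
    invertible, which gives the dimensions; and for [m = n] a square matrix with
    [O O^T = - d I] also has [O^T O = - d I], which exhibits every vector of the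
    dual code as a combination of the rows ([self_dual_row_code]).

    That the square roots exist is a matter of the order of the field only: by
    Euler's criterion, whether an element of the prime field is a square can be
    decided by an exponent depending on the order ([is_square_odd]), so the two
    fields of order [p ^ l] agree, and in a field of order [(p ^ l) ^ 2] every
    element of the prime field is a square. *)

(** * Codes spanned by the rows of a matrix *)

Section Codes.
Variable F : finFieldType.

(** Seeing the code as the image of [w |-> w *m A] makes the dimension theory of
    linear maps available. *)
Lemma row_code_limg (M N : nat) (A : 'M[F]_(M, N)) :
  row_code A = limg (linfun (mulmxr A : 'rV_M -> 'rV_N)).
Proof.
apply/eqP; rewrite eqEsubv; apply/andP; split.
  apply/span_subvP=> _ /imageP[i _ ->]; rewrite rowE.
  by apply/memv_imgP; exists (delta_mx 0 i); rewrite ?memvf ?lfunE.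
apply/subvP=> _ /memv_imgP[w _ ->]; rewrite lfunE /= mulmx_sum_row.
by apply: memv_suml => i _; apply/memvZ/memv_span/image_f.
Qed.

Lemma row_codeP (M N : nat) (A : 'M[F]_(M, N)) (u : 'rV[F]_N) :
  reflect (exists w : 'rV_M, u = w *m A) (u \in row_code A).
Proof.
rewrite row_code_limg; apply: (iffP memv_imgP) => [[w _ ->]|[w ->]]; exists w.
- by rewrite lfunE.
- exact: memvf.
- by rewrite lfunE.
Qed.

Lemma dim_row_code (M N : nat) (A : 'M[F]_(M, N)) (A' : 'M[F]_(N, M)) :
  A *m A' = 1%:M -> \dim (row_code A) = M.
Proof.
move=> AA'; rewrite row_code_limg limg_dim_eq.
  by rewrite dimvf dim_matrix; apply: mul1n.
suff /eqP-> : lker (linfun (mulmxr A : 'rV_M -> 'rV_N)) == 0%VS.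
  by rewrite capv0.
apply/lker0P => u w; rewrite !lfunE /= => eq_uw.
by rewrite -[u]mulmx1 -[w]mulmx1 -AA' !mulmxA eq_uw.
Qed.

Lemma dotrE (N : nat) (u w : 'rV[F]_N) : dotr u w = (u *m w^T) 0 0.
Proof. by rewrite mxE; apply: eq_bigr => i _; rewrite mxE. Qed.

Lemma dual_row_codeP (M N : nat) (A : 'M[F]_(M, N)) (u : 'rV[F]_N) :
  reflect (u *m A^T = 0) (u \in dual_code (row_code A)).
Proof.
rewrite inE; apply: (iffP forall_inP) => [uC|uA _ /row_codeP[w ->]].
  apply/rowP=> i; rewrite [RHS]mxE.
  have /uC/eqP uC0 : row i A \in row_code A.
    by apply/row_codeP; exists (delta_mx 0 i); rewrite rowE.
  by rewrite -uC0 mxE; apply: eq_bigr => j _; rewrite !mxE.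
by rewrite dotrE trmx_mul mulmxA uA mul0mx mxE.
Qed.

Lemma self_orthogonal_row_code (M N : nat) (A : 'M[F]_(M, N)) :
  A *m A^T = 0 -> self_orthogonal (row_code A).
Proof.
move=> AAT _ /row_codeP[u ->]; apply/dual_row_codeP.
by rewrite -mulmxA AAT mulmx0.
Qed.

(** Since [O] is square, the scaled transpose of [O] is also a left inverse, so
    [O^T *m O] is known.  A vector [(u1, u2)] of the dual code satisfies
    [s u1 = - u2 O^T]; then [w = s^-1 u1] gives [w O = - s^-2 u2 O^T O = u2],
    that is, [(u1, u2) = w (s I, O)]. *)
Lemma self_dual_row_code (m : nat) (s : F) (O : 'M[F]_m) : s != 0 ->
  O *m O^T = - (s ^+ 2)%:M -> self_dual (row_code (row_mx (s *: 1%:M) O)).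
Proof.
move=> s0 OOT; have s20 : s ^+ 2 != 0 by rewrite expf_neq0.
have OTO : O^T *m O = - (s ^+ 2)%:M.
  have : O *m (- (s ^- 2) *: O^T) = 1%:M.
    by rewrite -scalemxAr OOT scalerN scaleNr opprK scale_scalar_mx mulVf.
  move/mulmx1C; rewrite -scalemxAl => /(congr1 (fun A => - (s ^+ 2) *: A)).
  by rewrite scalerA mulrNN mulfV // scale1r => ->; rewrite scaleNr scalemx1.
have orth : row_mx (s *: 1%:M) O *m (row_mx (s *: 1%:M) O)^T = 0.
  rewrite tr_row_mx mul_row_col OOT linearZ /= trmx1 -scalemxAr mulmx1.
  by rewrite scalerA scalemx1 -expr2 subrr.
move=> u; apply/idP/dual_row_codeP => [uC|].
  exact/dual_row_codeP/self_orthogonal_row_code.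
rewrite -[u]hsubmxK; move: (lsubmx u) (rsubmx u) => u1 u2.
rewrite tr_row_mx mul_row_col linearZ /= trmx1 -scalemxAr mulmx1 => uA.
apply/row_codeP; exists (s^-1 *: u1); rewrite mul_mx_row; congr row_mx.
  by rewrite -scalemxAr mulmx1 scalerA mulfV // scale1r.
move/eqP: uA; rewrite addr_eq0 => /eqP/(congr1 (fun w => s^-1 *: w)).
rewrite scalerA mulVf // scale1r => ->.
rewrite scalerA -scalemxAl mulNmx -mulmxA OTO mulmxN opprK mul_mx_scalar.
by rewrite scalerA -invfM -expr2 mulVf // scale1r.
Qed.
End Codes.

(** * Squares among the elements of the prime field *)

Lemma natr_pchar_congr (R : nzRingType) (p a b : nat) :
  p \in [pchar R] -> a = b %[mod p] -> a%:R = b%:R :> R.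
Proof.
move=> pR ab; rewrite (divn_eq a p) (divn_eq b p) ab !natrD !natrM.
by rewrite (pcharf0 pR) !mulr0.
Qed.

Lemma eqr_natr_pchar (R : nzRingType) (p a b : nat) :
  p \in [pchar R] -> (a%:R == b%:R :> R) = (a == b %[mod p]).
Proof.
move=> pR; apply/eqP/eqP; last exact: natr_pchar_congr.
wlog leba : a b / (b <= a)%N => [W ab|].
  by case/orP: (leq_total b a) => le; [apply: W|symmetry; apply: W].
move=> ab; apply/eqP; rewrite eqn_mod_dvd // (dvdn_pcharf pR) natrB // ab.
by rewrite subrr.
Qed.

(** In characteristic two the Frobenius map is onto. *)
Lemma is_square_even (F : finFieldType) (c : F) : ~~ odd #|F| -> is_square c.
Proof.
move=> ev; apply/existsP; exists (c ^+ #|F|./2).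
by rewrite -exprM muln2 even_halfK ?expf_card.
Qed.

(** Euler's criterion.  With the exponent [(#|F| + 1) / 2] instead of
    [(#|F| - 1) / 2] it holds for [c = 0] too.  If the power of a nonzero [c] is
    [c], write [c] as a power [g ^+ i] of a generator of the unit group: the
    condition forces [i] to be even. *)
Lemma is_square_odd (F : finFieldType) (c : F) : odd #|F| ->
  is_square c = (c ^+ uphalf #|F| == c).
Proof.
move=> oF; have F2 : ((uphalf #|F|).*2 = #|F|.+1)%N.
  by rewrite uphalf_half oF doubleD -{2}(odd_double_half #|F|) oF.
apply/existsP/eqP => [[s /eqP <-]|cE].
  by rewrite -exprM mul2n F2 exprS expf_card -expr2.
have [->|c0] := eqVneq c 0; first by exists 0; rewrite expr0n.
have /cyclicP[g gE] := field_unit_group_cyclic [group of [set: {unit F}]].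
have og : #[g]%g = #|F|.-1 by rewrite orderE -gE card_finField_unit.
have /cycleP[i ci] : finField_unit c0 \in <[g]>%g by rewrite -gE inE.
have cg : c = val g ^+ i by rewrite -FinRing.val_unitX -ci.
have h : c ^+ #|F|./2 = 1.
  apply: (mulfI c0); rewrite mulr1 -exprS -{2}cE; congr (_ ^+ _).
  by rewrite uphalf_half oF.
have : (g ^+ (i * #|F|./2) == 1)%g.
  by rewrite -val_eqE /= FinRing.val_unitX exprM -cg h.
rewrite -order_dvdn og => dv.
have F3 : (#|F|.-1 = 2 * #|F|./2)%N.
  by rewrite -{1}(odd_double_half #|F|) oF mul2n.
have F4 : (0 < #|F|./2)%N by rewrite half_gt0 finNzRing_gt1.
move: dv; rewrite F3 dvdn_pmul2r // => /dvdnP[j ij].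
by exists (val g ^+ j); rewrite cg ij exprM.
Qed.

(** Two fields of the same order are isomorphic, but Euler's criterion shows
    directly that they have the same squares in the prime field: it becomes a
    congruence modulo [p] that mentions only the order. *)
Lemma is_square_natr_card (p : nat) (E F : finFieldType) (c : nat) :
  p \in [pchar E] -> p \in [pchar F] -> #|E| = #|F| ->
  is_square (c%:R : E) = is_square (c%:R : F).
Proof.
move=> pE pF EF; case: (boolP (odd #|F|)) => [oF|eF].
  have oE : odd #|E| by rewrite EF.
  rewrite !is_square_odd // -!natrX.
  by rewrite (eqr_natr_pchar _ _ pE) (eqr_natr_pchar _ _ pF) EF.
by rewrite !is_square_even ?EF.
Qed.

Lemma natr_exp_pchar (R : comNzRingType) (p l c : nat) : p \in [pchar R] ->
  (c%:R : R) ^+ (p ^ l) = c%:R.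
Proof.
move=> pR; elim: l => [|l IH]; first by rewrite expr1.
by rewrite expnSr exprM IH -(pFrobenius_autE pR) pFrobenius_aut_nat.
Qed.

(** With [q = p ^ l] and [c ^+ q = c], the exponent of Euler's criterion in the
    field of order [q ^ 2] decomposes as [q * ((q - 1) / 2) + (q + 1) / 2], so
    it acts on [c] like [(q - 1) / 2 + (q + 1) / 2 = q]. *)
Lemma is_square_quadratic (p l : nat) (F : finFieldType) (c : nat) :
  p \in [pchar F] -> #|F| = ((p ^ l) ^ 2)%N -> is_square (c%:R : F).
Proof.
move=> pF cF; case: (boolP (odd #|F|)) => [oF|]; last exact: is_square_even.
rewrite is_square_odd // cF; move: oF; rewrite cF oddX /= => oq.
have := natr_exp_pchar l c pF; move: (p ^ l)%N oq => q oq cq.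
have -> : uphalf (q ^ 2) = (q * q./2 + uphalf q)%N.
  by rewrite !uphalf_half oddX oq -{1}(odd_double_half q) oq; nia.
have hq : (q./2 + uphalf q = q)%N by lia.
by rewrite exprD exprM cq -exprD hq cq.
Qed.

(** Lets the statements about squares of natural numbers apply to [- d]. *)
Lemma opprn_natr (R : nzRingType) (p c : nat) : p \in [pchar R] ->
  - c%:R = (p.-1 * c)%:R :> R.
Proof.
move=> pR; have p_gt0 : (0 < p)%N by apply/prime_gt0/(pcharf_prime pR).
apply/eqP; rewrite eq_sym -addr_eq0 -natrD -mulSnr prednK //.
by rewrite natrM (pcharf0 pR) mul0r.
Qed.

(** * Orbit matrices *)

Section OrbitLists.
Variables (gT : finGroupType) (D : {group gT}) (T : finType) (to : action D T).
Variables (G : {group gT}) (sGD : G \subset D) (s f n : nat).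
Variables (V : 'I_(f + n) -> {set T}) (VP : orbit_list to G s V).

Lemma orbit_list_orbit i x : x \in V i -> V i = orbit to G x.
Proof.
case: VP => _ Vorb _ _.
have: V i \in [set V j | j : 'I_(f + n)] by apply: imset_f.
rewrite Vorb => /imsetP[y _ ->] xy; exact/esym/orbit_in_eqP.
Qed.

Lemma orbit_list_neq0 i : exists x, x \in V i.
Proof.
case: VP => _ Vorb _ _.
have: V i \in [set V j | j : 'I_(f + n)] by apply: imset_f.
by rewrite Vorb => /imsetP[y _ ->]; exists y; apply: orbit_refl.
Qed.

(** The listed orbits partition [T]: [idx x] is the position of the orbit of
    [x].  Sums over [T] are split along the fibres of [idx]. *)
Lemma orbit_list_index :
  exists idx : T -> 'I_(f + n), forall x i, (x \in V i) = (idx x == i).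
Proof.
case: (VP) => Vinj Vorb _ _.
have /fin_all_exists[idx idxP] : forall x, exists i, x \in V i.
  move=> x; have: orbit to G x \in [set orbit to G y | y : T] by apply: imset_f.
  rewrite -Vorb => /imsetP[i _ Ei]; exists i; rewrite -Ei; exact: orbit_refl.
exists idx => x i; apply/idP/eqP => [xi|<-] //; apply: Vinj.
by rewrite (orbit_list_orbit xi) (orbit_list_orbit (idxP x)).
Qed.

End OrbitLists.

(** The incidence relation is arbitrary, so that the points and the blocks can
    be exchanged. *)
Lemma card_incident_perm (P B : finType) (I : P -> B -> bool)
    (g : {perm P}) (h : {perm B}) (X : {set P}) (y : B) :
  (forall x z, I (g x) (h z) = I x z) ->
  (forall x, (g x \in X) = (x \in X)) ->
  #|[set x in X | I x (h y)]| = #|[set x in X | I x y]|.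
Proof.
move=> gI gX; rewrite -(card_preimset _ (@perm_inj _ g)).
by apply: eq_card => x; rewrite !inE gI gX.
Qed.

Section OrbitMatrix.
Variables (P B : finType) (I : P -> B -> bool).
Variables (G : {group {perm P} * {perm B}}) (G_aut : G \subset design_aut I).
Variables (s f1 n f2 m : nat).
Variables (PO : 'I_(f1 + n) -> {set P}) (BO : 'I_(f2 + m) -> {set B}).
Hypothesis point_orbits : orbit_list (point_act P B) G s PO.
Hypothesis block_orbits : orbit_list (block_act P B) G s BO.

Let a := orbit_mx I BO PO.

Lemma sub_point_dom : G \subset act_dom (point_act P B).
Proof. by apply/subsetP=> g _; rewrite !inE. Qed.

Lemma sub_block_dom : G \subset act_dom (block_act P B).
Proof. by apply/subsetP=> g _; rewrite !inE. Qed.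

Lemma orbit_mxE i j y : y \in BO i -> a i j = #|[set x in PO j | I x y]|.
Proof.
have [x0 xj] := orbit_list_neq0 point_orbits j.
move=> yi; rewrite mxE (orbit_list_orbit sub_point_dom point_orbits xj).
rewrite (orbit_list_orbit sub_block_dom block_orbits yi).
by apply: orbit_entryE => //; apply: orbit_refl.
Qed.

Lemma point_degree_const i j x x' : x \in PO j -> x' \in PO j ->
  #|[set y in BO i | I x y]| = #|[set y in BO i | I x' y]|.
Proof.
move=> xj; rewrite (orbit_list_orbit sub_point_dom point_orbits xj).
case/imsetP=> g gG ->; symmetry.
have [y0 yi] := orbit_list_neq0 block_orbits i.
apply: (card_incident_perm (I := fun y x => I x y) (g := g.2) (h := g.1))
  => [z w|z].
  by move/(subsetP G_aut): gG; rewrite inE => /forallP/(_ w)/forallP/(_ z)/eqP.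
rewrite (orbit_list_orbit sub_block_dom block_orbits yi).
exact: (acts_act (acts_orbit _ _ sub_block_dom)).
Qed.

(** Both sides count the incident pairs between the two orbits, once through the
    points and once through the blocks. *)
Lemma flag_count i j x : x \in PO j ->
  (#|PO j| * #|[set y in BO i | I x y]| = #|BO i| * a i j)%N.
Proof.
move=> xj; rewrite -!sum_nat_const.
rewrite (eq_bigr (fun x => \sum_(y in BO i) I x y)%N); last first.
  move=> x' x'j; rewrite (point_degree_const i xj x'j) -sum1dep_card.
  by rewrite big_mkcondr; apply: eq_bigr => y _; case: (I _ _).
rewrite exchange_big; apply: eq_bigr => y yi.
rewrite (orbit_mxE _ yi) -sum1dep_card big_mkcondr.
by apply: eq_bigr => z _; case: (I _ _).
Qed.

(** The part, in the point orbit [j], of the number of pairs [(x, z)] such that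
    [x] is incident with both [y] and [z], and [z] is in the block orbit [i]. *)
Definition flags_on i j y :=
  (\sum_(x in PO j | I x y) #|[set z in BO i | I x z]|)%N.

(** Each of the [a i j] points of orbit [j] on [y] lies on
    [#|BO i'| * a i' j / #|PO j|] blocks of orbit [i']; the division is avoided
    by multiplying out. *)
Lemma card_flags_on i i' j y : y \in BO i ->
  (#|PO j| * flags_on i' j y = #|BO i'| * (a i j * a i' j))%N.
Proof.
move=> yi; rewrite big_distrr /=.
rewrite (eq_bigr (fun=> #|BO i'| * a i' j)%N); last first.
  by move=> x /andP[xj _]; apply: flag_count.
by rewrite sum_nat_cond_const -(orbit_mxE _ yi) mulnCA.
Qed.

Lemma sum_flags_on i y :
  (\sum_j flags_on i j y = \sum_(z in BO i) block_meet I y z)%N.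
Proof.
have [idx idxP] := orbit_list_index sub_point_dom point_orbits.
transitivity (\sum_(x | I x y) #|[set z in BO i | I x z]|)%N.
  rewrite (partition_big idx xpredT) //=; apply: eq_bigr => j _.
  by apply: eq_bigl => x; rewrite idxP andbC.
transitivity (\sum_(x | I x y) \sum_(z in BO i) I x z)%N.
  apply: eq_bigr => x _; rewrite -sum1dep_card big_mkcondr.
  by apply: eq_bigr => z _; case: (I _ _).
rewrite exchange_big; apply: eq_bigr => z _.
rewrite /block_meet -sum1dep_card [RHS]big_mkcondr.
by apply: eq_bigr => x _; case: (I x z).
Qed.

Variables (p k d : nat) (F : fieldType) (pF : p \in [pchar F]).
Hypothesis block_card : forall y, #|[set x | I x y]| = k.
Hypothesis k_mod : (k = 0 %[mod p])%N.
Hypothesis meet_mod :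
  forall y z : B, y != z -> (block_meet I y z = d %[mod p])%N.
Hypotheses (s_gt0 : (0 < s)%N) (p_dvd_s : (p %| s)%N).

Let O1 : 'M[F]_(f2, f1) := map_mx (fun c : nat => c%:R) (ulsubmx a).
Let O2 : 'M[F]_(m, n) := map_mx (fun c : nat => c%:R) (drsubmx a).

(** Every [z] contributes [d] except [z = y], which contributes [k], that is,
    [0]. *)
Lemma sum_block_meet y (Y : {set B}) :
  (\sum_(z in Y) block_meet I y z)%:R = d%:R * (#|Y|%:R - (y \in Y)%:R) :> F.
Proof.
have meetE z : (block_meet I y z)%:R = d%:R - d%:R *+ (z == y) :> F.
  have [->|zy] := eqVneq z y; last first.
    by rewrite subr0 eq_sym in zy *; apply: natr_pchar_congr (meet_mod zy).
  rewrite subrr; have <- : k%:R = 0 :> F := natr_pchar_congr pF k_mod.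
  rewrite -(block_card y); congr (_%:R).
  by apply: eq_card => x; rewrite !inE andbb.
rewrite natr_sum (eq_bigr _ (fun z _ => meetE z)) sumrB sumr_const.
rewrite mulrBr mulr_natr; congr (_ - _).
have [yY|yY] := boolP (y \in Y).
  rewrite (bigD1 y) //= eqxx big1 ?addr0 ?mulr1 // => z /andP[_ /negPf->] //.
rewrite mulr0 big1 // => z zY; rewrite (_ : (z == y) = false) //.
by apply/negP=> /eqP zy; rewrite zy (negPf yY) in zY.
Qed.

Lemma sum_flags_on_char i i' y : y \in BO i ->
  (\sum_j (flags_on i' j y)%:R) = d%:R * (#|BO i'|%:R - (i == i')%:R) :> F.
Proof.
move=> yi; rewrite -natr_sum sum_flags_on sum_block_meet.
have [idx idxP] := orbit_list_index sub_block_dom block_orbits.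
by move: yi; rewrite !idxP => /eqP ->.
Qed.

(** On fixed points the flags are counted by the product of entries.  An orbit
    of length [s] lies entirely on a fixed block or misses it, so it contributes
    a multiple of [s]. *)
Lemma fixed_gram : O1 *m O1^T = const_mx d%:R - d%:R%:M.
Proof.
case: (point_orbits) => _ _ PO1 POs; case: (block_orbits) => _ _ BO1 _.
apply/matrixP=> i i'; rewrite !mxE.
have [y yi] := orbit_list_neq0 block_orbits (lshift m i).
have := sum_flags_on_char (lshift m i') yi.
rewrite big_split_ord /= [X in _ + X]big1 ?addr0 => [|j _].
  rewrite BO1 (inj_eq (@lshift_inj _ _)) mulrBr mulr1 mulr_natr => <-.
  apply: eq_bigr => j _; have := card_flags_on (lshift m i') (lshift n j) yi.
  by rewrite PO1 BO1 !mul1n => ->; rewrite !mxE natrM.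
(* For a long point orbit both entries are divisible by s, while their product
   is s times the number of flags; one factor s remains. *)
have dvd_s i0 : (s %| a (lshift m i0) (rshift f1 j))%N.
  have [x xj] := orbit_list_neq0 point_orbits (rshift f1 j).
  have := flag_count (lshift m i0) xj; rewrite POs BO1 mul1n => <-.
  exact: dvdn_mulr.
have := card_flags_on (lshift m i') (rshift f1 j) yi.
rewrite POs BO1 mul1n; case/dvdnP: (dvd_s i') => e ->.
rewrite mulnA mulnC => /eqP; rewrite eqn_pmul2r // => /eqP->.
apply/eqP; rewrite -(dvdn_pcharf pF).
exact/dvdn_mulr/(dvdn_trans p_dvd_s)/dvd_s.
Qed.

(** A fixed point on one block of an orbit lies on all [s] of them, so the fixed
    points contribute multiples of [s]; on long point orbits the two lengths
    cancel. *)
Lemma moved_gram : O2 *m O2^T = - d%:R%:M.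
Proof.
case: (point_orbits) => _ _ PO1 POs; case: (block_orbits) => _ _ _ BOs.
have s0 : s%:R = 0 :> F by apply/eqP; rewrite -(dvdn_pcharf pF).
apply/matrixP=> i i'; rewrite !mxE.
have [y yi] := orbit_list_neq0 block_orbits (rshift f2 i).
have := sum_flags_on_char (rshift f2 i') yi.
rewrite big_split_ord /= [X in X + _]big1 ?add0r => [|j _].
  rewrite BOs s0 sub0r (inj_eq (@rshift_inj _ _)) mulrN mulr_natr => <-.
  apply: eq_bigr => j _; have := card_flags_on (rshift f2 i') (rshift f1 j) yi.
  rewrite POs BOs => /eqP; rewrite eqn_pmul2l // => /eqP->.
  by rewrite !mxE natrM.
have := card_flags_on (rshift f2 i') (lshift n j) yi.
by rewrite PO1 BOs mul1n => ->; rewrite natrM s0 mul0r.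
Qed.
End OrbitMatrix.

(** * The two families of codes *)

Lemma gen1_gram (F : finFieldType) (f2 m f1 n : nat)
    (a : 'M[nat]_(f2 + m, f1 + n)) (s t : F) :
  let O := map_mx (fun c : nat => c%:R) (ulsubmx a) in
  gen1 a s t *m (gen1 a s t)^T = (s ^+ 2)%:M + O *m O^T + const_mx (t ^+ 2).
Proof.
rewrite /gen1 !tr_row_mx !mul_row_col linearZ /= trmx1 -scalemxAr mulmx1.
rewrite scalerA scalemx1; congr (_ + _).
by apply/matrixP=> i j; rewrite !mxE big_ord1 !mxE.
Qed.

Lemma gen2_gram (F : finFieldType) (f2 m f1 n : nat)
    (a : 'M[nat]_(f2 + m, f1 + n)) (s : F) :
  let O := map_mx (fun c : nat => c%:R) (drsubmx a) in
  gen2 a s *m (gen2 a s)^T = (s ^+ 2)%:M + O *m O^T.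
Proof.
rewrite /gen2 !tr_row_mx !mul_row_col linearZ /= trmx1 -scalemxAr mulmx1.
by rewrite scalerA scalemx1.
Qed.

Lemma dim_gen1 (F : finFieldType) (f2 m f1 n : nat)
    (a : 'M[nat]_(f2 + m, f1 + n)) (s t : F) :
  s != 0 -> \dim (row_code (gen1 a s t)) = f2.
Proof.
move=> s0; apply: (@dim_row_code _ _ _ _ (col_mx (col_mx (s^-1)%:M 0) 0)).
by rewrite !mul_row_col !mulmx0 !addr0 -scalemxAl mul1mx scale_scalar_mx mulfV.
Qed.

Lemma dim_gen2 (F : finFieldType) (f2 m f1 n : nat)
    (a : 'M[nat]_(f2 + m, f1 + n)) (s : F) :
  s != 0 -> \dim (row_code (gen2 a s)) = m.
Proof.
move=> s0; apply: (@dim_row_code _ _ _ _ (col_mx (s^-1)%:M 0)).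
by rewrite mul_row_col mulmx0 addr0 -scalemxAl mul1mx scale_scalar_mx mulfV.
Qed.

Theorem theorem13 (p l : nat) (p_prime : prime p)
    (Fq : finFieldType) (card_Fq : #|Fq| = (p ^ l)%N)
    (P B : finType) (I : P -> B -> bool) (v k r d : nat)
    (design : design1 I v k r)
    (k_mod : (k = 0 %[mod p])%N)
    (meet_mod : forall y z : B, y != z -> (block_meet I y z = d %[mod p])%N)
    (G : {group {perm P} * {perm B}}) (G_aut : G \subset design_aut I)
    (alpha : nat) (alpha_bounds : (1 <= alpha <= l)%N)
    (f1 n f2 m : nat)
    (PO : 'I_(f1 + n) -> {set P}) (BO : 'I_(f2 + m) -> {set B})
    (point_orbits : orbit_list (point_act P B) G (p ^ alpha) PO)
    (block_orbits : orbit_list (block_act P B) G (p ^ alpha) BO) :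
  (forall F : finFieldType,
     #|F| = (if is_square (d%:R : Fq) && is_square (- d%:R : Fq)
             then p ^ l else (p ^ l) ^ 2)%N ->
     [/\ exists s : F, s ^+ 2 = d%:R,
         exists t : F, t ^+ 2 = - d%:R
       & forall s t : F, s ^+ 2 = d%:R -> t ^+ 2 = - d%:R ->
           let C := row_code (gen1 (orbit_mx I BO PO) s t) in
           self_orthogonal C /\ (~~ (p %| d)%N -> \dim C = f2)])
  /\
  (forall F : finFieldType,
     #|F| = (if is_square (d%:R : Fq) then p ^ l else (p ^ l) ^ 2)%N ->
     (exists s : F, s ^+ 2 = d%:R) /\
     (forall s : F, s ^+ 2 = d%:R ->
        let C := row_code (gen2 (orbit_mx I BO PO) s) in
        [/\ self_orthogonal C,
            ~~ (p %| d)%N -> \dim C = m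
          & ~~ (p %| d)%N -> m = n -> self_dual C])).
Proof.
case: design => _ block_card _; case/andP: alpha_bounds => alpha_gt0 _.
have s_gt0 : (0 < p ^ alpha)%N by rewrite expn_gt0 prime_gt0.
have p_dvd_s : (p %| p ^ alpha)%N by rewrite dvdn_exp.
have pE : p \in [pchar Fq] := card_finPcharP card_Fq p_prime.
have pcharF (F : finFieldType) (b : bool) :
    #|F| = (if b then p ^ l else (p ^ l) ^ 2)%N -> p \in [pchar F].
  by case: b => cF; [|rewrite -expnM in cF]; apply: card_finPcharP cF p_prime.
have sqF (F : finFieldType) (b : bool) (c : nat) :
    #|F| = (if b then p ^ l else (p ^ l) ^ 2)%N ->
    (b -> is_square (c%:R : Fq)) -> exists s : F, s ^+ 2 = c%:R.
  move=> cF sqc; suff /existsP[s /eqP sE] : is_square (c%:R : F) by exists s.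
  have pF := pcharF F b cF; case: b cF sqc => cF sqc.
    by rewrite -(is_square_natr_card c pE pF (etrans card_Fq (esym cF))) sqc.
  exact: is_square_quadratic pF cF.
have s_neq0 (F : finFieldType) (s : F) : p \in [pchar F] ->
    s ^+ 2 = d%:R -> ~~ (p %| d)%N -> s != 0.
  move=> pF sE; rewrite (dvdn_pcharf pF) -sE; apply: contraNneq => ->.
  by rewrite expr0n.
split=> F cF; have pF := pcharF _ _ cF.
  split.
  - by apply: (sqF _ _ _ cF) => /andP[].
  - rewrite (opprn_natr d pF); apply: (sqF _ _ _ cF) => /andP[_].
    by rewrite (opprn_natr d pE).
  move=> s t sE tE C; split; last by move/(s_neq0 F s pF sE); apply: dim_gen1.
  apply: self_orthogonal_row_code; rewrite gen1_gram.
  rewrite (fixed_gram G_aut point_orbits block_orbits pF block_card k_mod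
             meet_mod s_gt0 p_dvd_s) sE tE.
  by apply/matrixP=> i j; rewrite !mxE [X in X + _]addrC subrK subrr.
split; first exact: (sqF _ _ _ cF).
move=> s sE C.
have gram := moved_gram G_aut point_orbits block_orbits pF block_card k_mod
               meet_mod s_gt0 p_dvd_s.
split; last 2 first.
- by move/(s_neq0 F s pF sE); apply: dim_gen2.
- move/(s_neq0 F s pF sE) => s0 mn; subst n.
  by apply: self_dual_row_code => //; rewrite gram sE.
by apply: self_orthogonal_row_code; rewrite gen2_gram gram sE subrr.
Qed.
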